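(* Let $\lambda\in[1/2,1]$ be fixed. Let $\Sigma=(a_1,\dots,a_n)$ be an $\mathcal{F}_{\lambda,n}$-sum distinct sequence in $\mathbb{Z}$ that is $M$-bounded. Then, as $n\to\infty$, $$ M \geq (1 + o(1)) \cdot \begin{cases} \dfrac{1}{\sqrt{2\pi n}} \cdot 2^n & \text{if } \lambda=1/2; \\[2mm] \sqrt{\dfrac{2}{\pi n}} \cdot 2^n &\text{if } \lambda \in (1/2, 1]. \end{cases} $$
   Context: $\mathcal{F}_{\lambda,n}$ denotes the family of all subsets of $\{1,\dots,n\}$ of size at most $\lambda n$. A sequence $\Sigma=(a_1,\dots,a_n)$ of integers is $M$-bounded if $a_i\in[0,M]$ for all $i$. For $A\subseteq\{1,\dots,n\}$ put $S(A)=\sum_{i\in A}a_i$. The sequence is $\mathcal{F}_{\lambda,n}$-sum distinct if $S(A_1)\neq S(A_2)$ for all distinct $A_1,A_2\in\mathcal{F}_{\lambda,n}$. The $o(1)$ is a quantity depending only on $n$ and $\lambda$ (not on $\Sigma$ or $M$) that tends to $0$ as $n\to\infty$ with $\lambda$ fixed; i.e. for every $\varepsilon>0$ there is $N$ such that for all $n\ge N$ and every such $\Sigma$ and $M$ the inequality holds with $1+o(1)$ replaced by $1-\varepsilon$. *)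

(* Defs.v *)
From mathcomp Require Import all_boot all_order all_algebra.
From mathcomp Require Import all_classical all_reals all_analysis.
Set Implicit Arguments.
Unset Strict Implicit.
Unset Printing Implicit Defensive.
Import Order.TTheory GRing.Theory Num.Theory.
Local Open Scope ring_scope.

(* The index set {1, ..., n} is rendered as 'I_n. *)
Definition small_sets (R : realType) (lambda : R) (n : nat) : {set {set 'I_n}} :=
  [set A : {set 'I_n} | #|A|%:R <= lambda * n%:R].

Definition subset_sum (n : nat) (a : 'I_n -> int) (A : {set 'I_n}) : int :=
  \sum_(i in A) a i.

Definition sum_distinct (n : nat) (F : {set {set 'I_n}}) (a : 'I_n -> int) : Prop :=
  forall A1 A2 : {set 'I_n},
    A1 \in F -> A2 \in F -> A1 <> A2 -> subset_sum a A1 <> subset_sum a A2.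

Definition bounded_seq (R : realType) (M : R) (n : nat) (a : 'I_n -> int) : Prop :=
  forall i : 'I_n, 0 <= a i /\ (a i)%:~R <= M.

Definition main_term (R : realType) (lambda : R) (n : nat) : R :=
  if lambda == 1 / 2 then 1 / Num.sqrt (2 * pi * n%:R) * 2 ^+ n
  else Num.sqrt (2 / (pi * n%:R)) * 2 ^+ n.

(* Main.v *)
Require Import Defs.
From mathcomp Require Import all_boot all_order all_algebra.
From mathcomp Require Import all_classical all_reals all_analysis.
From mathcomp Require Import zify ring lra.
Import Order.TTheory GRing.Theory Num.Theory.
Import numFieldNormedType.Exports.
Local Open Scope ring_scope.
Set Implicit Arguments.
Unset Strict Implicit.
Unset Printing Implicit Defensive.

(** Write [T] for the total of the sequence and [X(A) = 2 S(A) - T], which is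
    the signed sum of the [a_i] with sign [+] on [A] and [-] off [A].  The
    theorem is an anti-concentration statement in reverse: when all weights lie
    in [[0, M]], many sets have [|X(A)| <= 2M], whereas sum-distinctness allows
    at most [2M + 1] members of the family there.

    The number of sets with [|X(A)| <= 2M] is at least the central binomial
    coefficient [C(n+1, (n+1)/2)] ([card_window_ge]).  More generally, the
    number of sign patterns with [|X| <= jM] is at least the number of
    [n]-step simple walks on the nonnegative integers started at [j] and killed
    at [0] ([count_window_ge]).  Shrinking [M] only makes the count smaller, so
    [M] may be taken to be the largest weight [a_i].  Conditioning on the sign
    of that weight turns the pair of events [|Y + M| <= jM], [|Y - M| <= jM]
    into the pair [|Y| <= (j-1)M], [|Y| <= (j+1)M], which is exactly the
    recursion of the killed walk.  The reflection principle then gives the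
    walk count in closed form ([survivors_closed]).

    It remains to see how many of these sets have size at most [lambda n].  The
    set of [A] with [|X(A)| <= 2M] is closed under complement, and one of [A],
    [~: A] is small, so at least half of it is small; this is sharp enough when
    [lambda = 1/2] and accounts for the factor [2] between the two cases.  When
    [lambda > 1/2], Chebyshev's inequality bounds the number of large sets by
    [O(2^n / n)], which is negligible against [2^n / sqrt n].

    Finally [C(n, n/2) ~ sqrt(2 / (pi n)) 2^n] is Wallis' formula, of which only
    the lower bound is used; it follows from comparing the integrals of
    consecutive powers of [sin] over [[0, pi/2]]. *)

(** * Signed sums concentrate at least as much as the killed simple walk *)

Definition signed_sum (T : finType) (a : T -> int) (J A : {set T}) : int :=
  \sum_(i in J) (if i \in A then a i else - a i).

(** The number of simple random walk paths with [m] steps started at [j] that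
    are never at [0]. *)
Fixpoint survivors (m j : nat) : nat :=
  match m, j with
  | 0, _ => (0 < j)%N
  | _.+1, 0 => 0%N
  | m'.+1, j'.+1 => survivors m' j' + survivors m' j'.+2
  end.

Lemma survivors0 m : survivors m 0 = 0%N.
Proof. by case: m. Qed.

Lemma bin_half_uphalf m : 'C(m, uphalf m) = 'C(m, m./2).
Proof.
rewrite -bin_sub; last by rewrite leq_uphalf_double; lia.
by congr 'C(_, _); lia.
Qed.

(** Reflection principle.  The increment from [j] to [j + 2] satisfies Pascal's
    rule in [m]; taking the sum of the two roundings of [(m + j + 1) / 2] treats
    both parities of [m + j] at once.  The value at [j = 1] has to be carried
    along because the recursion is killed at the boundary. *)
Lemma survivors_closed m :
  survivors m 1 = 'C(m, m./2) /\
  forall j, survivors m j.+2 =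
    (survivors m j + 'C(m, (m + j).+1./2) + 'C(m, (m + j).+2./2))%N.
Proof.
elim: m => [|m [IH1 IH]]; first by split=> // -[|j].
have E2 : survivors m 2 = 'C(m.+1, m./2.+1).
  by rewrite IH survivors0 addn0 add0n binS addnC bin_half_uphalf.
split=> [|[|j]].
- rewrite /= survivors0 add0n E2.
  rewrite -(bin_half_uphalf m.+1); congr 'C(_, _).
- have -> : survivors m.+1 2 = (survivors m 1 + survivors m 3)%N by [].
  rewrite survivors0 IH IH1 addn0 !addn1 /=.
  by rewrite !binS bin_half_uphalf; lia.
- have -> k : survivors m.+1 k.+1 = (survivors m k + survivors m k.+2)%N by [].
  have -> k : survivors m.+1 k.+1 = (survivors m k + survivors m k.+2)%N by [].
  rewrite !IH !addnS !addSn /= !binS; lia.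
Qed.

Lemma survivors2 m : survivors m 2 = 'C(m.+1, m.+1./2).
Proof. by rewrite -(proj1 (survivors_closed m.+1)) /= survivors0. Qed.

(** Conditioning on whether [i] is selected. *)
Lemma big_powersetD1 (V : nmodType) (T : finType) (J : {set T}) (i : T)
    (F : {set T} -> V) : i \in J ->
  \sum_(A in powerset J) F A = \sum_(A in powerset (J :\ i)) (F A + F (i |: A)).
Proof.
move=> iJ; rewrite big_split (bigID (fun A : {set T} => i \in A)) /= addrC.
congr (_ + _).
  by apply: eq_bigl => A; rewrite !powersetE subsetD1.
rewrite (reindex_onto (fun A => i |: A) (fun A => A :\ i)) /=; last first.
  by move=> A /andP[_ iA]; rewrite finset.setD1K.
apply: eq_bigl => A; rewrite !powersetE subsetD1 finset.subUset finset.sub1set iJ finset.setU11 /= andbT.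
congr (_ && _); apply/eqP/idP => [<-|iA]; first by rewrite !inE eqxx.
by rewrite finset.setU1K.
Qed.

Lemma signed_sumD1 (T : finType) (a : T -> int) (J A : {set T}) (i : T) :
  i \in J -> A \subset J :\ i ->
  signed_sum a J A = signed_sum a (J :\ i) A - a i /\
  signed_sum a J (i |: A) = signed_sum a (J :\ i) A + a i.
Proof.
move=> iJ; rewrite subsetD1 => /andP[_ /negPf iA].
rewrite /signed_sum !(big_setD1 i iJ) /= iA finset.setU11 addrC; split=> //.
rewrite addrC; congr (_ + _); apply: eq_bigr => k; rewrite !inE => /andP[/negPf -> _] //.
Qed.

(** Equal weights are extremal.  In the induction on [J] the bound [M] is first
    lowered to the largest weight, which can only lose sets; splitting on the
    sign of that weight then reproduces the recursion of [survivors]. *)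
Lemma count_window_ge (T : finType) (a : T -> int) (J : {set T}) (M : int)
    (j : nat) :
  0 <= M -> (forall i, i \in J -> 0 <= a i <= M) ->
  (survivors #|J| j <=
     \sum_(A in powerset J) (`|signed_sum a J A| <= M *+ j)%R)%N.
Proof.
move: {2}#|J| (erefl #|J|) => m; elim: m J M j => [|m IH] J M j cJ M0 aM.
  move/cards0_eq: (cJ) => ->.
  rewrite powerset0 big_set1 cards0 /signed_sum big_set0 normr0 mulrn_wge0 //=.
  by case: j.
rewrite cJ; case: j => [//|j].
have [i0 i0J] : exists i, i \in J by apply/finset.set0Pn; rewrite -card_gt0 cJ.
pose i := [arg max_(i > i0 in J) a i]%O.
have [iJ amax] : i \in J /\ forall k, k \in J -> a k <= a i.
  by rewrite /i; case: arg_maxP.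
have [ai0 aiM] := andP (aM i iJ).
have cK : #|J :\ i| = m by move: (cardsD1 i J); rewrite iJ cJ => -[].
have aK k : k \in J :\ i -> 0 <= a k <= a i.
  by rewrite !inE => /andP[_ kJ]; rewrite amax // andbT; case/andP: (aM k kJ).
have := leq_add (IH _ _ j cK ai0 aK) (IH _ _ j.+2 cK ai0 aK).
rewrite cK => /leq_trans; apply.
rewrite [leqRHS](@big_powersetD1 _ _ _ i) // -big_split /=.
apply: leq_sum => A; rewrite powersetE => AK.
have [-> ->] := signed_sumD1 a iJ AK.
have aij : 0 <= a i *+ j by apply: mulrn_wge0.
have aiMj : a i *+ j <= M *+ j by rewrite lerMn2r aiM orbT.
(* With b = a i and Y the sum over the other weights, this says that
   [|Y| <= jb] + [|Y| <= (j+2)b] = [|Y - b| <= (j+1)b] + [|Y + b| <= (j+1)b]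
   for indicators; the bound on the right only grows when b is replaced by M. *)
rewrite !mulrS.
move: (signed_sum _ _ _) aij aiMj => Y; move: (a i) (a i *+ j) (M *+ j) ai0 aiM.
move=> b bj Mj *; lia.
Qed.

(** Cross terms cancel: this is the variance of a sum of independent signs. *)
Lemma sum_sqr_signed_sum (T : finType) (a : T -> int) (J : {set T}) :
  \sum_(A in powerset J) signed_sum a J A ^+ 2 =
    (\sum_(i in J) a i ^+ 2) *+ 2 ^ #|J|.
Proof.
move: {2}#|J| (erefl #|J|) => m; elim: m J => [|m IH] J cJ.
  by move/cards0_eq: (cJ) => ->; rewrite powerset0 big_set1 /signed_sum !big_set0 cards0.
have [i iJ] : exists i, i \in J by apply/finset.set0Pn; rewrite -card_gt0 cJ.
have cK : #|J :\ i| = m by move: (cardsD1 i J); rewrite iJ cJ => -[].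
rewrite (@big_powersetD1 _ _ _ i) //.
rewrite (eq_bigr (fun A => signed_sum a (J :\ i) A ^+ 2 *+ 2 + a i ^+ 2 *+ 2));
  last first.
  move=> A; rewrite powersetE => /(signed_sumD1 a iJ)[-> ->]; ring.
rewrite big_split /= sumrMnl IH // sumr_const card_powerset (big_setD1 i iJ) /= cK cJ.
by rewrite expnS mulrnDl addrC -!mulrnA (mulnC 2%N) mulrnDl muln2 -addnn [in RHS]mulrnDr.
Qed.

(** * Wallis' lower bound for the central binomial coefficient *)

(** The antiderivatives of [sin ^+ n] given by the reduction formula, so that
    integrals of powers of [sin] become differences of values. *)
Fixpoint sin_prim {R : realType} (n : nat) : R -> R :=
  match n with
  | 0 => id
  | 1 => - @cos R
  | m.+2 => m.+2%:R^-1 \*: (m.+1%:R \*: sin_prim m - @sin R ^+ m.+1 * @cos R)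
  end.

Lemma is_derive_sin_prim (R : realType) n (x : R) :
  is_derive x 1 (sin_prim n) (sin x ^+ n).
Proof.
suff [] : is_derive x 1 (sin_prim n) (sin x ^+ n) /\
    is_derive x 1 (sin_prim n.+1) (sin x ^+ n.+1) by [].
elim: n => [|n [IH0 IH1]].
  split; first by rewrite expr0; apply: is_derive_id.
  by apply: is_derive_eq; rewrite opprK expr1.
split=> //=; apply: is_derive_eq.
have c2 : cos x ^+ 2 = 1 - sin x ^+ 2 by rewrite cos2sin2.
rewrite !fctE /GRing.scale /=.
have -> : cos x * (n.+1%:R * sin x ^+ n * cos x) =
    n.+1%:R * sin x ^+ n * cos x ^+ 2 by ring.
rewrite c2 !exprS; field; rewrite -natr1; have := ler0n R n; lra.
Qed.

(** The integral of [sin ^+ n] over [[0, pi/2]]. *)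
Definition wallis (R : realType) n : R := sin_prim n (pi / 2) - sin_prim n 0.

Lemma wallis0 (R : realType) : wallis R 0 = pi / 2.
Proof. by rewrite /wallis /= subr0. Qed.

Lemma wallis1 (R : realType) : wallis R 1 = 1.
Proof. by rewrite /wallis /= !fctE cos0 cos_pihalf oppr0 opprK add0r. Qed.

Lemma wallisSS (R : realType) n : n.+2%:R * wallis R n.+2 = n.+1%:R * wallis R n.
Proof.
rewrite /wallis /= !fctE sin0 cos_pihalf expr0n /= mulr0 mul0r !subr0 /GRing.scale /=.
by rewrite -!mulrBr mulVKf ?pnatr_eq0.
Qed.

(** On [[0, pi/2]] the powers of [sin] decrease; the mean value theorem turns
    this into a comparison of their integrals. *)
Lemma wallis_decr (R : realType) n : wallis R n.+1 <= wallis R n.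
Proof.
pose f := sin_prim n - sin_prim n.+1 : R -> R.
have df (x : R) : is_derive x 1 f (sin x ^+ n - sin x ^+ n.+1).
  by apply: is_deriveB; apply: is_derive_sin_prim.
have pi2 : 0 <= pi / 2 :> R by have := pi_ge0 R; lra.
suff : f 0 <= f (pi / 2) by rewrite /f /wallis !fctE; lra.
have [|c] := MVT_segment pi2 (fun x _ => df x).
  by apply: derivable_within_continuous => x _; apply: ex_derive.
rewrite in_itv /= => /andP[c0 c1] E.
have s0 : 0 <= sin c by apply: sin_ge0_pi; lra.
rewrite -subr_ge0 E subr0 mulr_ge0 // exprS -[X in X - _]mul1r -mulrBl.
by rewrite mulr_ge0 ?exprn_ge0 // subr_ge0 sin_le1.
Qed.

Lemma bin_doubleS p : 'C(p.+1.*2, p.+1) = (2 * 'C(p.*2.+1, p))%N.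
Proof.
rewrite doubleS binS -[X in (X + _)%N]bin_sub; last by lia.
by rewrite (_ : p.*2.+1 - p.+1 = p)%N; lia.
Qed.

Lemma bin_centralS p :
  (p.+1 * 'C(p.+1.*2, p.+1) = 2 * p.*2.+1 * 'C(p.*2, p))%N.
Proof.
have := mul_bin_down p.*2.+1 p.
rewrite bin_doubleS /= (_ : p.*2.+1 - p = p.+1)%N; last by lia.
nia.
Qed.

Lemma wallis_bin (R : realType) p :
  wallis R p.*2 * 4 ^+ p = pi / 2 * 'C(p.*2, p)%:R /\
  wallis R p.*2.+1 * (p.*2.+1%:R * 'C(p.*2, p)%:R) = 4 ^+ p.
Proof.
elim: p => [|p [IH0 IH1]].
  by rewrite wallis0 wallis1 bin0 expr0 !mulr1.
have := bin_centralS p; move/(congr1 (fun k => k%:R : R)); rewrite !natrM.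
have := wallisSS R p.*2; have := wallisSS R p.*2.+1.
rewrite -!doubleS -[in X in _ = X -> _]muln2 natrM => w1 w0 c1.
have P0 : p.+1%:R != 0 :> R by rewrite pnatr_eq0.
rewrite !exprS; split; last first.
  rewrite mulrCA mulrA w1 mulrAC.
  transitivity (4 * (wallis R p.*2.+1 * (p.*2.+1%:R * 'C(p.*2, p)%:R)));
    last by rewrite IH1.
  transitivity (2 * (p.+1%:R * 'C(p.+1.*2, p.+1)%:R) * wallis R p.*2.+1);
    first by ring.
  by rewrite c1; ring.
apply: (mulfI P0).
transitivity (2 * (p.+1.*2%:R * wallis R p.+1.*2) * 4 ^+ p).
  by rewrite -muln2 natrM; ring.
rewrite w0 [RHS]mulrCA c1.
transitivity (2 * p.*2.+1%:R * (wallis R p.*2 * 4 ^+ p)); first by ring.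
by rewrite IH0; ring.
Qed.

(** The inequality [wallis p.*2.+1 <= wallis p.*2] in closed form. *)
Lemma bin_double_ge (R : realType) p :
  2 * (4 ^+ p) ^+ 2 <= 'C(p.*2, p)%:R ^+ 2 * (pi * p.*2.+1%:R) :> R.
Proof.
have [e0 e1] := wallis_bin R p.
have := wallis_decr R p.*2.
move: (4 ^+ p) (exprn_ge0 p (ler0n R 4)) e0 e1 => q q0.
have : 0 <= (p.*2.+1%:R * 'C(p.*2, p)%:R : R) by rewrite mulr_ge0.
move: (wallis _ _) (wallis _ _) => x y Qc e0 e1 xy.
have := ler_wpM2r (mulr_ge0 Qc q0) xy.
rewrite mulrA e1 [leRHS]mulrCA e0 => h.
have -> : 'C(p.*2, p)%:R ^+ 2 * (pi * p.*2.+1%:R) =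
    2 * (p.*2.+1%:R * 'C(p.*2, p)%:R * (pi / 2 * 'C(p.*2, p)%:R)) :> R.
  by field.
by rewrite expr2 ler_pM2l.
Qed.

(** For odd [n] the central coefficient is half of the one for [n.+1], which is
    why [n.+2] appears. *)
Lemma central_bin_ge (R : realType) n :
  2 * (2 ^+ n) ^+ 2 <= ('C(n, n./2)%:R) ^+ 2 * (pi * n.+2%:R) :> R.
Proof.
have pi0 := pi_ge0 R.
have e4 k : 4 ^+ k = 2 ^+ k.*2 :> R by rewrite -mul2n exprM; congr (_ ^+ k); ring.
have [p [->|->]] : exists p, n = p.*2 \/ n = p.*2.+1.
- by exists n./2; case: (boolP (odd n)) => /= h; [right|left]; lia.
- rewrite doubleK -e4; apply: le_trans (bin_double_ge R p) _.
  by rewrite ler_wpM2l ?exprn_ge0 // ler_wpM2l // ler_nat.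
- rewrite (_ : p.*2.+1./2 = p); last by lia.
  have := bin_double_ge R p.+1; rewrite bin_doubleS natrM e4 doubleS !exprS.
  by nra.
Qed.

(** * Sets whose sum is near half of the total *)

Lemma card_le_interval (T : finType) (D : {set T}) (f : T -> int) (lo : int)
    (k : nat) :
  {in D &, injective f} -> (forall x, x \in D -> lo <= f x <= lo + k%:Z) ->
  (#|D| <= k.+1)%N.
Proof.
move=> injf fD; pose g x : 'I_k.+1 := inord `|f x - lo|%N.
have gE x : x \in D -> g x = `|f x - lo|%N :> nat.
  by move=> /fD xD; rewrite inordK //; lia.
rewrite -[leqRHS]card_ord -(card_in_imset (f := g)) ?max_card // => x y xD yD xy.
apply: injf => //; have := fD _ xD; have := fD _ yD.
have := gE _ xD; rewrite xy (gE _ yD); lia.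
Qed.

Definition window (n : nat) (a : 'I_n -> int) (M : int) : {set {set 'I_n}} :=
  [set A | `|signed_sum a [set: 'I_n] A| <= M *+ 2].

Lemma signed_sumTE n (a : 'I_n -> int) (A : {set 'I_n}) :
  signed_sum a [set: 'I_n] A = subset_sum a A *+ 2 - \sum_i a i.
Proof.
rewrite /signed_sum /subset_sum (big_mkcond (fun i => i \in A)) /= -sumrMnl -sumrB.
by apply: eq_big => i; rewrite ?inE // => _; case: ifP => _; ring.
Qed.

Lemma signed_sumTC n (a : 'I_n -> int) (A : {set 'I_n}) :
  signed_sum a [set: 'I_n] (~: A) = - signed_sum a [set: 'I_n] A.
Proof.
rewrite /signed_sum -sumrN; apply: eq_bigr => i _; rewrite inE.
by case: (i \in A); rewrite ?opprK.
Qed.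

Lemma card_window_ge n (a : 'I_n -> int) (M : int) :
  0 <= M -> (forall i, 0 <= a i <= M) ->
  ('C(n.+1, n.+1./2) <= #|window a M|)%N.
Proof.
move=> M0 aM; have := count_window_ge 2 M0 (fun i (_ : i \in [set: 'I_n]) => aM i).
rewrite cardsT card_ord survivors2 => /leq_trans; apply.
rewrite powersetT -sum1_card [leqRHS]big_mkcond [leqLHS]big_mkcond /=.
by apply: leq_sum => A _; rewrite !inE; case: ifP.
Qed.

(** Since [2 S(A) - T] has the parity of [T], the sums [S(A)] of sets in the
    window lie in an interval containing at most [2m + 1] integers. *)
Lemma card_distinct_window_le n (a : 'I_n -> int) (F : {set {set 'I_n}}) (m : nat) :
  sum_distinct F a -> (#|window a m :&: F| <= (2 * m).+1)%N.
Proof.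
move=> dF; have := divz_eq (\sum_i a i) 2; have := modz_ge0 (\sum_i a i) (isT : 2%:Z != 0).
have := ltz_pmod (\sum_i a i) (isT : 0 < 2%:Z).
set q := (_ %/ _)%Z; set r := (_ %% _)%Z => r2 r0 E.
apply: (@card_le_interval _ _ (subset_sum a) (q - m%:Z)).
  move=> A B; rewrite !inE => /andP[_ AF] /andP[_ BF] AB.
  by apply/eqP/negPn/negP => /eqP nAB; apply: (dF A B).
move=> A; rewrite !inE signed_sumTE => /andP[+ _].
move: (subset_sum a A) E r0 r2; move: (\sum_i a i) q r => t q r s -> *; lia.
Qed.

(** The window is closed under complement, and [A] or [~: A] has size at most
    [n / 2]. *)
Lemma card_window_le_half (R : realType) n (a : 'I_n -> int) (M : int) (lambda : R) :
  1 / 2 <= lambda ->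
  (#|window a M| <= 2 * #|window a M :&: small_sets lambda n|)%N.
Proof.
move=> l2; set D := _ :&: _.
have : window a M \subset D :|: [set ~: A | A in D].
  apply/fintype.subsetP => A AW; rewrite inE.
  have [AF|/negP nAF] := boolP (A \in small_sets lambda n); first by rewrite inE AW AF.
  apply/orP; right; apply/imsetP; exists (~: A); last by rewrite finset.setCK.
  move: AW nAF; rewrite !inE signed_sumTC normrN => -> /negP /=; rewrite -ltNge.
  have : #|A|%:R + #|~: A|%:R = n%:R :> R by rewrite -natrD cardsC card_ord.
  have := ler0n R n; nra.
move/subset_leq_card/leq_trans; apply; rewrite (leq_trans (leq_card_setU _ _)) //.
by rewrite mul2n -addnn leq_add2l leq_imset_card.
Qed.

(** Chebyshev's inequality: with unit weights the signed sum of [A] is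
    [2 #|A| - n], whose mean square over all sets is [n]. *)
Lemma card_large_sets_le (R : realType) n (lambda : R) :
  1 / 2 <= lambda ->
  #|~: small_sets lambda n|%:R * (4 * (lambda - 1 / 2) ^+ 2 * n%:R ^+ 2) <=
    n%:R * 2 ^+ n.
Proof.
move=> l2; have := sum_sqr_signed_sum (fun _ => 1) [set: 'I_n].
rewrite powersetT cardsT card_ord sumr_const cardsT card_ord.
move/(congr1 (fun k => k%:~R : R)); rewrite expr1n -mulrnA mulrz_nat natrM natrX => <-.
rewrite [leRHS](rmorph_sum intr) [leRHS](bigID (fun A => A \in ~: small_sets lambda n)) /=.
rewrite -[leLHS]addr0 lerD ?sumr_ge0 //; last first.
  by move=> A _; rewrite rmorphXn sqr_ge0.
rewrite mulr_natl -sumr_const big_mkcond [leRHS]big_mkcond ler_sum // => A _.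
rewrite finset.in_setT /= inE; case: ifP => //; rewrite inE -ltNge => lA.
rewrite rmorphXn /= signed_sumTE /subset_sum !sumr_const card_ord.
rewrite rmorphB /= rmorphMn /= !mulrz_nat.
rewrite (_ : 4 * _ * _ = (2 * (lambda - 1 / 2) * n%:R) ^+ 2); last by ring.
have ln : 0 <= (lambda - 1 / 2) * n%:R by rewrite mulr_ge0 ?subr_ge0.
by rewrite lerXn2r ?nnegrE; nra.
Qed.

(** * Asymptotics and the theorem *)

(** The asymptotic value of the central binomial coefficient: [2 ^ n] times the
    density at its mode of the Gaussian of variance [n / 4]. *)
Definition gauss_peak (R : realType) (n : nat) : R :=
  Num.sqrt (2 / (pi * n%:R)) * 2 ^+ n.

Lemma gauss_peak_ge0 (R : realType) n : 0 <= gauss_peak R n.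
Proof. by rewrite mulr_ge0 ?sqrtr_ge0 ?exprn_ge0. Qed.

Lemma sqr_gauss_peak (R : realType) n : (0 < n)%N ->
  gauss_peak R n ^+ 2 * (pi * n%:R) = 2 * (2 ^+ n) ^+ 2.
Proof.
move=> n0; have nR : n%:R != 0 :> R by rewrite pnatr_eq0 -lt0n.
have p0 := pi_gt0 R; have pn0 : pi != 0 :> R by rewrite gt_eqF.
rewrite exprMn sqr_sqrtr; last by rewrite divr_ge0 ?mulr_ge0 // ltW.
by move: pi pn0 => p pn0; field; rewrite pn0 nR.
Qed.

Lemma main_term_half (R : realType) (n : nat) :
  main_term (1 / 2 : R) n = gauss_peak R n / 2.
Proof.
rewrite /main_term eqxx /gauss_peak [RHS]mulrAC; congr (_ * _).
have [->|n0] := eqVneq n 0%N; first by rewrite !mulr0 invr0 mulr0 sqrtr0 invr0 mulr0 mul0r.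
have nR : n%:R != 0 :> R by rewrite pnatr_eq0.
have p0 := pi_gt0 R; have pn0 : pi != 0 :> R by rewrite gt_eqF.
have -> : 2 / (pi * n%:R) = 2 ^+ 2 / (2 * pi * n%:R) :> R.
  by move: pi pn0 => p pn0; field; rewrite pn0 nR.
rewrite [in RHS]sqrtrM ?exprn_ge0 // sqrtr_sqr ger0_norm // sqrtrV; last by rewrite !mulr_ge0 // ltW.
by field; rewrite sqrtr_eq0 -ltNge !mulr_gt0 // ltr0n lt0n.
Qed.

Lemma pi_le4 (R : realType) : pi <= 4 :> R.
Proof. have := pihalf_lt2 R; lra. Qed.

(** The number [O(2 ^ n / n)] of large sets is negligible against the peak. *)
Lemma gauss_peak_dominates (R : realType) (c : R) : 0 < c ->
  exists N, forall n, (N <= n)%N -> 2 ^+ n <= c * n%:R * gauss_peak R n.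
Proof.
move=> c0; exists (Num.truncn (2 / c ^+ 2)).+1 => n Nn.
have n0 : (0 < n)%N by apply: leq_trans Nn.
have nR : 0 < n%:R :> R by rewrite ltr0n.
have hn : 2 <= n%:R * c ^+ 2.
  rewrite -ler_pdivrMr ?exprn_gt0 //; apply/ltW/(lt_le_trans (truncnS_gt _)).
  by rewrite ler_nat.
have m0 := gauss_peak_ge0 R n.
have cg0 : 0 <= c * n%:R * gauss_peak R n by rewrite 2?mulr_ge0 // ltW.
rewrite -(@ler_pXn2r _ 2%N) ?nnegrE ?exprn_ge0 //.
have := sqr_gauss_peak R n0; have := pi_le4 R; have := pi_gt0 R.
move: (gauss_peak R n) => g; rewrite !exprMn; move: (g ^+ 2) (sqr_ge0 g) => G G0.
move: (2 ^+ n ^+ 2) => q p0 p4 Gq.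
have : G * (pi * n%:R) <= G * (4 * n%:R) by rewrite ler_wpM2l // ler_wpM2r // ltW.
rewrite Gq => h.
have : G * n%:R * 2 <= G * n%:R * (n%:R * c ^+ 2) by rewrite ler_wpM2l // mulr_ge0 // ltW.
lra.
Qed.

Lemma gauss_peak_unbounded (R : realType) (c : R) : 0 < c ->
  exists N, forall n, (N <= n)%N -> 1 <= c * gauss_peak R n.
Proof.
move=> c0; have [N HN] := gauss_peak_dominates c0; exists N.+1 => n Nn.
have nR : 0 < n%:R :> R by rewrite ltr0n; apply: leq_trans Nn.
rewrite -(ler_pM2r nR) mul1r mulrAC; apply: le_trans (HN n (ltnW Nn)).
by rewrite -natrX ler_nat ltnW // ltn_expl.
Qed.

Lemma central_bin_asymp (R : realType) (eta : R) : 0 < eta -> eta <= 1 ->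
  exists N, forall n, (N <= n)%N ->
    (1 - eta) * (2 * gauss_peak R n) <= 'C(n.+1, n.+1./2)%:R.
Proof.
move=> eta0 eta1; exists (Num.truncn (3 / eta)).+1 => n Nn.
have n0 : (0 < n)%N by apply: leq_trans Nn.
have nR : 0 < n%:R :> R by rewrite ltr0n.
have hn : 3 <= n%:R * eta.
  rewrite -ler_pdivrMr //; apply/ltW/(lt_le_trans (truncnS_gt _)).
  by rewrite ler_nat.
have m0 := gauss_peak_ge0 R n.
have eta1' : 0 <= 1 - eta by lra.
have eg0 : 0 <= (1 - eta) * (2 * gauss_peak R n) by rewrite !mulr_ge0.
rewrite -(@ler_pXn2r _ 2%N) ?nnegrE //.
have := sqr_gauss_peak R n0; have := central_bin_ge R n.+1; have p0 := pi_gt0 R.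
move: (gauss_peak R n) => g; rewrite !exprMn [2 ^+ n.+1]exprS exprMn -[n.+3]addn3 natrD.
move: (g ^+ 2) (sqr_ge0 g) => G G0.
move: ('C(_, _)%:R ^+ 2) => K; move: (2 ^+ n ^+ 2) => q hK hG.
have pn3 : 0 < pi * (n%:R + 3) :> R by rewrite mulr_gt0 //; lra.
rewrite -(ler_pM2r pn3); apply: le_trans hK.
have -> : 2 * (2 ^+ 2 * q) = 4 * (G * (pi * n%:R)) by rewrite hG; ring.
have Gp : 0 <= G * pi by rewrite mulr_ge0 // ltW.
have : (1 - eta) ^+ 2 * (n%:R + 3) <= n%:R.
  have : (1 - eta) ^+ 2 <= 1 - eta by rewrite expr2; nra.
  by nra.
move/(ler_wpM2l Gp); lra.
Qed.

Lemma bounded_seq_window (R : realType) (M : R) n (a : 'I_n -> int)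
    (F : {set {set 'I_n}}) :
  (0 < n)%N -> bounded_seq M a -> sum_distinct F a ->
  exists m : int, ('C(n.+1, n.+1./2) <= #|window a m|)%N /\
    #|window a m :&: F|%:R <= 2 * M + 1.
Proof.
move=> n0 aM dF.
have M0 : 0 <= M by have [a0 /(le_trans _)->] := aM (Ordinal n0); rewrite ?ler0z.
exists (Num.truncn M)%:Z; split.
  apply: card_window_ge => // i; have [ai0 aiM] := aM i; rewrite ai0 /=.
  move: ai0 aiM; case: (a i) => // k _; rewrite lez_nat truncn_ge_nat //.
have := card_distinct_window_le (Num.truncn M) dF.
rewrite -(ler_nat R) => /le_trans; apply.
by rewrite -natr1 natrM lerD2r ler_wpM2l // truncn_le.
Qed.

Theorem theorem2p3 (R : realType) (lambda : R)
    (hlambda : 1 / 2 <= lambda <= 1) :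
  forall eps : R, 0 < eps ->
  exists N : nat, forall n : nat, (N <= n)%N ->
  forall (M : R) (a : 'I_n -> int),
    bounded_seq M a ->
    sum_distinct (small_sets lambda n) a ->
    M >= (1 - eps) * main_term lambda n.
Proof.
move=> eps eps0; have [l2 _] := andP hlambda.
(* Half of eps goes to the central binomial coefficient, the other half to the
   additive 1 in the count and to the large sets. *)
pose eta := Num.min (eps / 2) 1.
have eta0 : 0 < eta by rewrite lt_min; lra.
have eta1 : eta <= 1 by rewrite ge_min lexx orbT.
have eta2 : eta <= eps / 2 by rewrite ge_min lexx.
have [N1 binN] := central_bin_asymp eta0 eta1.
have [N2 peakN] := @gauss_peak_unbounded R (eps / 2) ltac:(lra).
have [lE|lN] := eqVneq lambda (1 / 2).
  exists (maxn N1 N2).+1 => n nN M a aM dF.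
  have n0 : (0 < n)%N by lia.
  have [m [Wge Wle]] := bounded_seq_window n0 aM dF.
  have {binN} := binN n ltac:(lia); have {peakN} := peakN n ltac:(lia).
  have := card_window_le_half a m l2.
  move: Wge; rewrite lE main_term_half in Wle *.
  rewrite -!(ler_nat R) natrM.
  have := gauss_peak_ge0 R n; move: (gauss_peak R n) => g g0 Wge Whalf g1 hbin.
  have : (1 - eps / 2) * (2 * g) <= (1 - eta) * (2 * g) by nra.
  lra.
have d0 : 0 < lambda - 1 / 2 by rewrite lt_neqAle eq_sym subr_eq0 lN subr_ge0.
pose d2 := 4 * (lambda - 1 / 2) ^+ 2.
have d20 : 0 < d2 by rewrite mulr_gt0 // exprn_gt0.
have [N3 domN] := @gauss_peak_dominates R (eps / 2 * d2) ltac:(rewrite mulr_gt0 //; lra).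
exists (maxn N1 (maxn N2 N3)).+1 => n nN M a aM dF.
have n0 : (0 < n)%N by lia.
have nR : 0 < n%:R :> R by rewrite ltr0n.
have [m [Wge Wle]] := bounded_seq_window n0 aM dF.
have {binN} := binN n ltac:(lia); have {peakN} := peakN n ltac:(lia).
have {domN} := domN n ltac:(lia); have := card_large_sets_le n l2.
have : (#|window a m| <= #|window a m :&: small_sets lambda n| +
    #|~: small_sets lambda n|)%N.
  rewrite -[leqLHS](cardsID (small_sets lambda n)) leq_add2l subset_leq_card //.
  by rewrite finset.setDE finset.subsetIr.
rewrite /main_term (negbTE lN) -/(gauss_peak R n).
move: Wge Wle; rewrite -!(ler_nat R) natrD -/d2.
move: (#|~: _|%:R) (#|_|%:R) (#|_|%:R) => L W WF.
have := gauss_peak_ge0 R n; move: (gauss_peak R n) (2 ^+ n) => g q g0 Wge WFle WL hL hdom g1 hbin.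
have hLg : L <= eps / 2 * g.
  have dn : 0 < d2 * n%:R by rewrite mulr_gt0.
  rewrite -(ler_pM2r dn) -(ler_pM2r nR).
  have {}hL : L * (d2 * n%:R) * n%:R <= n%:R * q.
    by rewrite [leLHS](_ : _ = L * (d2 * n%:R ^+ 2)) //; ring.
  apply: (le_trans hL).
  by have := ler_wpM2l (ltW nR) hdom; lra.
have : (1 - eps / 2) * (2 * g) <= (1 - eta) * (2 * g) by nra.
lra.
Qed.
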